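(* Let $k$ be a field of characteristic zero and let $\mathbf{cAlg}_k$ be the category of commutative unital $k$-algebras. Let $\mathbb V_\boxplus:\mathbf{cAlg}_k\to\mathbf{cAlg}_k$ be the functor $\mathbb V_\boxplus(A)=(A^{\mathbb N^*},\boxplus,\boxdot)$. Then there is a comonad $(\mathbb V_\boxplus,\Delta,\varepsilon)$ on $\mathbf{cAlg}_k$ whose co-multiplication $\Delta:\mathbb V_\boxplus\to\mathbb V_\boxplus^2$ is given, for $A\in\mathbf{cAlg}_k$, by the composite $$\Delta_A:\ \mathbb V_\boxplus(A)\xrightarrow{\ R_A\ }A^{\mathbb N^*}\xrightarrow{\ \delta_A\ }A^{\mathbb N^*\times\mathbb N^*}\cong (A^{\mathbb N^*})^{\mathbb N^*}\xrightarrow{\ (R_A^{-1})^{\mathbb N^*}\ }\mathbb V_\boxplus(A)^{\mathbb N^*}\xrightarrow{\ R^{-1}_{\mathbb V_\boxplus(A)}\ }\mathbb V_\boxplus^2(A),$$ and whose co-unit is $\varepsilon_A=\varepsilon^\sigma_A\circ R_A:\mathbb V_\boxplus(A)\to A$.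
   Context: $\mathbb N^*=\{1,2,\dots\}$. For $A\in\mathbf{cAlg}_k$, $R_A:A^{\mathbb N^*}\to A^{\mathbb N^*}$ is the $R$-transform, the natural bijection sending a moment sequence $(m_n)_{n\ge1}$ to its free cumulant sequence $(\kappa_n)_{n\ge1}$, determined by $m_n=\sum_{\pi\in\operatorname{NC}(n)}\prod_{V\in\pi}\kappa_{|V|}$, where $\operatorname{NC}(n)$ is the set of non-crossing partitions of $\{1,\dots,n\}$. The additive free convolution $\boxplus$ satisfies $R_A(a\boxplus b)=R_A(a)+R_A(b)$, and $a\boxdot b:=R_A^{-1}(R_A(a)\cdot R_A(b))$ with point-wise multiplication. $\mathbb V_\boxplus(A)$ carries the $k$-algebra structure for which $R_A:\mathbb V_\boxplus(A)\to A^{\mathbb N^*}$ is an isomorphism of $k$-algebras, $A^{\mathbb N^*}$ having point-wise operations. For the commutative $k$-algebra $B=\mathbb V_\boxplus(A)$, $R_B:\mathbb V_\boxplus(B)\to B^{\mathbb N^*}$ is the $R$-transform with coefficients in $B$. The map $\delta_A:A^{\mathbb N^*}\to A^{\mathbb N^*\times\mathbb N^*}$ is $(\delta_A(\underline a))_{m,n}=a_{m+n-1}$, equivalently $\delta_A(\underline a)=(\underline a,\partial\underline a,\partial^2\underline a,\dots)$ with $\partial(a_1,a_2,a_3,\dots)=(a_2,a_3,\dots)$; and $\varepsilon^\sigma_A:A^{\mathbb N^*}\to A$ is $\varepsilon^\sigma_A(\underline a)=a_1$. *)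

(* Defs.v *)
From HB Require Import structures.
From mathcomp Require Import all_boot all_order all_algebra.
From mathcomp Require Import boolp.

Set Implicit Arguments.
Unset Strict Implicit.
Unset Printing Implicit Defensive.

Import GRing.Theory.
Local Open Scope ring_scope.

(* MathComp's [comAlgType] requires [1 != 0]; the zero algebra is an object of
   the category of commutative unital algebras, so the structure is restated
   over possibly zero rings. It cannot be built on [lmodType]: the existing
   hierarchy has no join of [lSemiModType] and [pzSemiRingType]. *)
HB.mixin Record ComPzRing_isAlgebra (k : pzRingType) (A : Type)
    of GRing.ComPzRing A := {
  ascale : k -> A -> A;
  ascaleA : forall c d x, ascale c (ascale d x) = ascale (c * d) x;
  ascale1 : forall x, ascale 1 x = x;
  ascaleDr : forall c x y, ascale c (x + y) = ascale c x + ascale c y;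
  ascaleDl : forall c d x, ascale (c + d) x = ascale c x + ascale d x;
  ascaleAl : forall c x y, ascale c (x * y) = ascale c x * y
}.

#[short(type="comPzAlgType")]
HB.structure Definition ComPzAlgebra (k : pzRingType) :=
  {A of GRing.ComPzRing A & ComPzRing_isAlgebra k A}.

Record algHom (k : pzRingType) (A B : comPzAlgType k) := AlgHom {
  algHom_fun :> A -> B;
  algHom_zmod : zmod_morphism algHom_fun;
  algHom_monoid : monoid_morphism algHom_fun;
  algHom_scale : forall (c : k) x, algHom_fun (ascale c x) = ascale c (algHom_fun x)
}.

HB.instance Definition _ (k : pzRingType) (A B : comPzAlgType k)
  (f : algHom A B) := GRing.isZmodMorphism.Build A B f (algHom_zmod f).
HB.instance Definition _ (k : pzRingType) (A B : comPzAlgType k)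
  (f : algHom A B) := GRing.isMonoidMorphism.Build A B f (algHom_monoid f).

Lemma algHom_eq (k : pzRingType) (A B : comPzAlgType k) (f g : algHom A B) :
  f =1 g -> f = g.
Proof.
case: f g => [f fa fm fs] [g ga gm gs] /= /funext fg; subst g.
by rewrite (Prop_irrelevance fa ga) (Prop_irrelevance fm gm)
  (Prop_irrelevance fs gs).
Qed.

Section AlgHomCategory.
Variables (k : pzRingType).

Definition algHom_id (A : comPzAlgType k) : algHom A A.
Proof. by exists id. Defined.

Variables (A B C : comPzAlgType k) (g : algHom B C) (f : algHom A B).
Lemma algHom_comp_zmod : zmod_morphism (g \o f).
Proof. by move=> x y /=; rewrite !rmorphB. Qed.
Lemma algHom_comp_monoid : monoid_morphism (g \o f).
Proof. by split=> [|x y] /=; rewrite ?rmorph1 ?rmorphM. Qed.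
Lemma algHom_comp_scale c x : (g \o f) (ascale c x) = ascale c ((g \o f) x).
Proof. by rewrite /= !algHom_scale. Qed.
Definition algHom_comp : algHom A C :=
  AlgHom algHom_comp_zmod algHom_comp_monoid algHom_comp_scale.
End AlgHomCategory.

Record category := Category {
  Ob :> Type;
  Hom : Ob -> Ob -> Type;
  idm : forall X, Hom X X;
  comp : forall X Y Z, Hom Y Z -> Hom X Y -> Hom X Z;
  comp_idl : forall X Y (f : Hom X Y), comp (idm Y) f = f;
  comp_idr : forall X Y (f : Hom X Y), comp f (idm X) = f;
  comp_assoc : forall X Y Z W (h : Hom Z W) (g : Hom Y Z) (f : Hom X Y),
    comp h (comp g f) = comp (comp h g) f
}.
Arguments Hom {c}.
Arguments idm {c}.
Arguments comp {c X Y Z}.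

Record functor (C D : category) := Functor {
  Fobj :> C -> D;
  Fmap : forall X Y, Hom X Y -> Hom (Fobj X) (Fobj Y);
  Fmap_id : forall X, Fmap (idm X) = idm (Fobj X);
  Fmap_comp : forall X Y Z (g : Hom Y Z) (f : Hom X Y),
    Fmap (comp g f) = comp (Fmap g) (Fmap f)
}.
Arguments Fmap {C D} _ {X Y}.

Definition functor_id (C : category) : functor C C :=
  @Functor C C id (fun _ _ f => f) (fun _ => erefl) (fun _ _ _ _ _ => erefl).

Lemma functor_comp_id (C D E : category) (G : functor D E) (F : functor C D) X :
  Fmap G (Fmap F (idm X)) = idm (G (F X)).
Proof. by rewrite !Fmap_id. Qed.

Lemma functor_comp_comp (C D E : category) (G : functor D E) (F : functor C D)
    X Y Z (g : Hom Y Z) (f : Hom X Y) :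
  Fmap G (Fmap F (comp g f)) = comp (Fmap G (Fmap F g)) (Fmap G (Fmap F f)).
Proof. by rewrite !Fmap_comp. Qed.

Definition functor_comp (C D E : category) (G : functor D E) (F : functor C D) :
    functor C E :=
  @Functor C E (fun X => G (F X)) (fun _ _ f => Fmap G (Fmap F f))
    (functor_comp_id G F) (@functor_comp_comp C D E G F).

Record nattrans (C D : category) (F G : functor C D) := NatTrans {
  nt_app :> forall X, Hom (F X) (G X);
  nt_natural : forall X Y (f : Hom X Y),
    comp (nt_app Y) (Fmap F f) = comp (Fmap G f) (nt_app X)
}.

Record comonad (C : category) (T : functor C C) := Comonad {
  comult : nattrans T (functor_comp T T);
  counit : nattrans T (functor_id C);
  comult_coassoc : forall X,
    comp (comult (T X)) (comult X) = comp (Fmap T (comult X)) (comult X);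
  counit_l : forall X, comp (counit (T X)) (comult X) = idm (T X);
  counit_r : forall X, comp (Fmap T (counit X)) (comult X) = idm (T X)
}.

Section CAlg.
Variable k : pzRingType.
Let algComp (A B C : comPzAlgType k) := @algHom_comp k A B C.

Lemma cAlg_idl (A B : comPzAlgType k) (f : algHom A B) :
  algComp (algHom_id B) f = f.
Proof. exact: algHom_eq. Qed.
Lemma cAlg_idr (A B : comPzAlgType k) (f : algHom A B) :
  algComp f (algHom_id A) = f.
Proof. exact: algHom_eq. Qed.
Lemma cAlg_assoc (A B C D : comPzAlgType k)
    (h : algHom C D) (g : algHom B C) (f : algHom A B) :
  algComp h (algComp g f) = algComp (algComp h g) f.
Proof. exact: algHom_eq. Qed.

Definition cAlg : category :=
  @Category (comPzAlgType k) (@algHom k) (@algHom_id k) algComp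
    cAlg_idl cAlg_idr cAlg_assoc.
End CAlg.

Definition noncrossing n (P : {set {set 'I_n}}) : bool :=
  [forall V in P, forall W in P, (V != W) ==>
    [forall a in V, forall b in W, forall c in V, forall d in W,
      ~~ [&& (a < b)%N, (b < c)%N & (c < d)%N]]].

Definition NC n : {set {set {set 'I_n}}} :=
  [set P | partition P [set: 'I_n] && noncrossing P].

(* Throughout, a sequence (a_1, a_2, ...) indexed by the positive integers is
   encoded as [a : nat -> A] with [a i] standing for a_{i+1}. *)

Section RTransform.
Variable A : comPzRingType.
Implicit Types (m kappa : nat -> A).

(* The moment-cumulant formula; it is the inverse of the R-transform. *)
Definition Rinv kappa : nat -> A :=
  fun n => \sum_(P in NC n.+1) \prod_(V in P) kappa #|V|.-1.

(* The R-transform, by recursion: the one-block partition contributes the n-th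
   cumulant to the n-th moment and all other partitions only involve cumulants
   of smaller index. [cumulants m n] is the list of the first [n] cumulants. *)
Fixpoint cumulants m n : seq A :=
  if n is p.+1 then
    let s := cumulants m p in
    rcons s (m p - \sum_(P in NC p.+1 | P != [set setT])
                      \prod_(V in P) s`_(#|V|.-1))
  else [::].

Definition Rtransform m : nat -> A := fun n => (cumulants m n.+1)`_n.

Let lower kappa n : A :=
  \sum_(P in NC n.+1 | P != [set setT]) \prod_(V in P) kappa #|V|.-1.

Lemma one_block_NC n : [set setT] \in NC n.+1.
Proof.
rewrite inE; apply/andP; split.
  apply/and3P; split.
  - by rewrite /cover big_set1.
  - apply/trivIsetP => X Y; rewrite !inE => /eqP -> /eqP ->.
    by rewrite eqxx.
  - by rewrite inE eq_sym -card_gt0 cardsT card_ord.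
apply/forall_inP => V; rewrite inE => /eqP ->.
apply/forall_inP => W; rewrite inE => /eqP ->.
by rewrite eqxx.
Qed.

Lemma block_lt n (P : {set {set 'I_n.+1}}) (V : {set 'I_n.+1}) :
  P \in NC n.+1 -> P != [set setT] -> V \in P -> (#|V|.-1 < n)%N.
Proof.
rewrite inE => /andP[/and3P[_ /trivIsetP tP P0] _] PT VP.
have V0 : (0 < #|V|)%N.
  by rewrite card_gt0; apply: contraNneq P0 => <-.
suff: (#|V| < n.+1)%N by rewrite -[X in (X < _)%N -> _](prednK V0) ltnS.
rewrite -[X in (_ < X)%N]card_ord -cardsT; apply: proper_card.
rewrite properT; apply: contra PT => /eqP VT.
apply/eqP/setP => W; rewrite inE -VT.
apply/idP/eqP => [WP|-> //]; apply: contraNeq P0 => WV.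
have := tP W V WP VP WV; rewrite VT -setI_eq0 setIT => /eqP W0.
by rewrite -W0.
Qed.

Lemma RinvE kappa n : Rinv kappa n = kappa n + lower kappa n.
Proof.
rewrite /Rinv (bigD1 _ (one_block_NC n)) /= big_set1.
by rewrite cardsT card_ord.
Qed.

Lemma eq_lower kappa kappa' n :
  (forall i, (i < n)%N -> kappa i = kappa' i) -> lower kappa n = lower kappa' n.
Proof.
move=> e; apply: eq_bigr => P /andP[PN PT]; apply: eq_bigr => V VP.
exact/e/(block_lt PN PT VP).
Qed.

Lemma size_cumulants m n : size (cumulants m n) = n.
Proof. by elim: n => //= n IH; rewrite size_rcons IH. Qed.

Lemma nth_cumulants m n i : (i < n)%N -> (cumulants m n)`_i = Rtransform m i.
Proof.
elim: n => // n IH; rewrite ltnS leq_eqVlt => /orP[/eqP -> //|lt].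
by rewrite /= nth_rcons size_cumulants lt IH.
Qed.

Lemma RtransformE m n : Rtransform m n = m n - lower (Rtransform m) n.
Proof.
rewrite {1}/Rtransform /= nth_rcons size_cumulants ltnn eqxx.
by congr (_ - _); apply: eq_lower => i; apply: nth_cumulants.
Qed.

Lemma RtransformK : cancel Rtransform Rinv.
Proof. by move=> m; apply/funext => n; rewrite RinvE RtransformE subrK. Qed.

Lemma RinvK : cancel Rinv Rtransform.
Proof.
move=> kappa; apply/funext => n; elim/ltn_ind: n => n IH.
by rewrite RtransformE RinvE (eq_lower IH) addrK.
Qed.
End RTransform.

Lemma Rinv_map (A B : comPzRingType) (f : {rmorphism A -> B}) kappa :
  Rinv (f \o kappa) = f \o Rinv kappa.
Proof.
apply/funext => n /=; rewrite /Rinv rmorph_sum; apply: eq_bigr => P _.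
by rewrite rmorph_prod.
Qed.

Lemma Rtransform_map (A B : comPzRingType) (f : {rmorphism A -> B}) m :
  Rtransform (f \o m) = f \o Rtransform m.
Proof. by rewrite -{1}(RtransformK m) -Rinv_map RinvK. Qed.

(* The alias carries the structure transported along the R-transform, to be
   distinguished from the pointwise structure on [nat -> A]. *)
Definition Vboxplus (A : Type) : Type := nat -> A.

HB.instance Definition _ (A : Type) := gen_eqMixin (Vboxplus A).
HB.instance Definition _ (A : Type) := gen_choiceMixin (Vboxplus A).

Section VRing.
Variable A : comPzRingType.
Implicit Types a b c : Vboxplus A.

Definition boxplus a b : Vboxplus A :=
  Rinv (fun n => Rtransform a n + Rtransform b n).
Definition boxdot a b : Vboxplus A :=
  Rinv (fun n => Rtransform a n * Rtransform b n).
Definition boxzero : Vboxplus A := Rinv (fun=> 0 : A).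
Definition boxone : Vboxplus A := Rinv (fun=> 1 : A).
Definition boxopp a : Vboxplus A := Rinv (fun n => - Rtransform a n).

Lemma Vboxplus_inj a b : Rtransform a =1 Rtransform b -> a = b.
Proof. by move=> /funext ab; apply: (can_inj (@RtransformK A)). Qed.

Lemma boxplusA : associative boxplus.
Proof. by move=> a b c; apply: Vboxplus_inj => n; rewrite !RinvK addrA. Qed.
Lemma boxplusC : commutative boxplus.
Proof. by move=> a b; apply: Vboxplus_inj => n; rewrite !RinvK addrC. Qed.
Lemma boxplus0 : left_id boxzero boxplus.
Proof. by move=> a; apply: Vboxplus_inj => n; rewrite !RinvK add0r. Qed.
Lemma boxplusN : left_inverse boxzero boxopp boxplus.
Proof. by move=> a; apply: Vboxplus_inj => n; rewrite !RinvK addNr. Qed.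

HB.instance Definition _ := GRing.isZmodule.Build (Vboxplus A)
  boxplusA boxplusC boxplus0 boxplusN.

Lemma boxdotA : associative boxdot.
Proof. by move=> a b c; apply: Vboxplus_inj => n; rewrite !RinvK mulrA. Qed.
Lemma boxdotC : commutative boxdot.
Proof. by move=> a b; apply: Vboxplus_inj => n; rewrite !RinvK mulrC. Qed.
Lemma boxdot1 : left_id boxone boxdot.
Proof. by move=> a; apply: Vboxplus_inj => n; rewrite !RinvK mul1r. Qed.
Lemma boxdotDl : left_distributive boxdot boxplus.
Proof. by move=> a b c; apply: Vboxplus_inj => n; rewrite !RinvK mulrDl. Qed.

HB.instance Definition _ := GRing.Zmodule_isComPzRing.Build (Vboxplus A)
  boxdotA boxdotC boxdot1 boxdotDl.
End VRing.

Section VAlgebra.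
Variables (k : pzRingType) (A : comPzAlgType k).
Implicit Types (s t : k) (a b : Vboxplus A).

Definition boxscale s a : Vboxplus A := Rinv (fun n => ascale s (Rtransform a n)).

Lemma boxscaleA s t a : boxscale s (boxscale t a) = boxscale (s * t) a.
Proof. by apply: Vboxplus_inj => n; rewrite !RinvK ascaleA. Qed.
Lemma boxscale1 a : boxscale 1 a = a.
Proof. by apply: Vboxplus_inj => n; rewrite !RinvK ascale1. Qed.
Lemma boxscaleDr s a b : boxscale s (a + b) = boxscale s a + boxscale s b.
Proof. by apply: Vboxplus_inj => n; rewrite !RinvK ascaleDr. Qed.
Lemma boxscaleDl s t a : boxscale (s + t) a = boxscale s a + boxscale t a.
Proof. by apply: Vboxplus_inj => n; rewrite !RinvK ascaleDl. Qed.
Lemma boxscaleAl s a b : boxscale s (a * b) = boxscale s a * b.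
Proof. by apply: Vboxplus_inj => n; rewrite !RinvK ascaleAl. Qed.

HB.instance Definition _ := ComPzRing_isAlgebra.Build k (Vboxplus A)
  boxscaleA boxscale1 boxscaleDr boxscaleDl boxscaleAl.
End VAlgebra.

Section VFunctor.
Variable k : pzRingType.
Implicit Types A B C : comPzAlgType k.

Section Map.
Variables (A B : comPzAlgType k) (f : algHom A B).

Definition Vmap_fun (a : Vboxplus A) : Vboxplus B := fun n => f (a n).

Lemma Rtransform_Vmap a n :
  Rtransform (Vmap_fun a) n = f (Rtransform (a : nat -> A) n).
Proof. exact: (congr1 (@^~ n) (Rtransform_map f a)). Qed.

Lemma Vmap_zmod : zmod_morphism Vmap_fun.
Proof.
move=> a b; apply: Vboxplus_inj => n.
by rewrite Rtransform_Vmap !RinvK !Rtransform_Vmap rmorphB.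
Qed.

Lemma Vmap_monoid : monoid_morphism Vmap_fun.
Proof.
split=> [|a b]; apply: Vboxplus_inj => n.
  by rewrite Rtransform_Vmap !RinvK rmorph1.
by rewrite Rtransform_Vmap !RinvK !Rtransform_Vmap rmorphM.
Qed.

Lemma Vmap_scale (c : k) (a : Vboxplus A) :
  Vmap_fun (ascale c a) = ascale c (Vmap_fun a).
Proof.
apply: Vboxplus_inj => n.
by rewrite Rtransform_Vmap !RinvK !Rtransform_Vmap algHom_scale.
Qed.

Definition Vmap : algHom (Vboxplus A) (Vboxplus B) :=
  AlgHom Vmap_zmod Vmap_monoid Vmap_scale.
End Map.

Lemma Vmap_id A : Vmap (algHom_id A) = algHom_id (Vboxplus A).
Proof. exact: algHom_eq. Qed.
Lemma Vmap_comp A B C (g : algHom B C) (f : algHom A B) :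
  Vmap (algHom_comp g f) = algHom_comp (Vmap g) (Vmap f).
Proof. exact: algHom_eq. Qed.

Definition Vboxplus_functor : functor (cAlg k) (cAlg k) :=
  @Functor (cAlg k) (cAlg k)
    (fun A : comPzAlgType k => Vboxplus A : comPzAlgType k)
    Vmap Vmap_id Vmap_comp.
End VFunctor.

(* a_{m+n-1} in 1-based indexing becomes [a (m + n)] in 0-based indexing. *)
Definition delta (A : Type) (a : nat -> A) : nat -> nat -> A :=
  fun m n => a (m + n)%N.

Definition epsilon_sigma (A : Type) (a : nat -> A) : A := a 0%N.

(* The outer [Rinv] has coefficients in the ring [Vboxplus A]. *)
Definition Delta (A : comPzRingType) (a : Vboxplus A) : Vboxplus (Vboxplus A) :=
  @Rinv (Vboxplus A) (fun m => @Rinv A (delta (@Rtransform A a) m)).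

Definition epsilon (A : comPzRingType) (a : Vboxplus A) : A :=
  epsilon_sigma (@Rtransform A a).

(* Main.v *)
Require Import Defs.
From mathcomp Require Import all_boot all_order all_algebra.

(** The free cumulants [cumulant n : Vboxplus A -> A] are jointly injective
    algebra morphisms, natural in [A]: this is just the definition of the algebra
    structure on [Vboxplus A] by transport along the R-transform. An element of
    an iterated [Vboxplus] is therefore determined by its iterated cumulants,
    and the two structure maps have a transparent description in them:
      - [epsilon] is the cumulant at the neutral index [0];
      - the [n]-th cumulant of the [m]-th cumulant of [Delta a] is the
        [(m + n)]-th cumulant of [a].
    So the R-transform identifies [Vboxplus] with the comonad of functions on the
    additive monoid of natural numbers, whose comultiplication is precomposition
    with [+] and whose counit is evaluation at [0]. Coassociativity is the
    associativity of addition, and the two counit laws are [0 + n = n] and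
    [n + 0 = n]. That [Delta] is a natural algebra morphism follows from its
    iterated cumulants being cumulants, hence natural algebra morphisms. *)

Set Implicit Arguments.
Unset Strict Implicit.
Unset Printing Implicit Defensive.

Import GRing.Theory.
Local Open Scope ring_scope.

Section Cumulants.
Variables (k : pzRingType) (A : comPzAlgType k).
Implicit Types a b : Vboxplus A.

Lemma Rtransform_zmod n : zmod_morphism (fun a => @Rtransform A a n).
Proof. by move=> a b /=; rewrite !RinvK. Qed.

Lemma Rtransform_monoid n : monoid_morphism (fun a => @Rtransform A a n).
Proof. by split=> [|a b] /=; rewrite RinvK. Qed.

Lemma Rtransform_scale n (c : k) a :
  Rtransform (ascale c a : Vboxplus A) n = ascale c (@Rtransform A a n).
Proof. by rewrite RinvK. Qed.

(** Bundling the cumulants as morphisms over the same [k] lets every law below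
    be checked by pushing cumulants through morphisms; [cumulant 0] is also
    the counit itself, since it unfolds to [epsilon]. *)
Definition cumulant n : algHom (Vboxplus A) A :=
  AlgHom (Rtransform_zmod n) (Rtransform_monoid n) (Rtransform_scale n).

Lemma cumulant_inj a b : (forall n, cumulant n a = cumulant n b) -> a = b.
Proof. exact: Vboxplus_inj. Qed.
End Cumulants.

Lemma cumulant_Vmap (k : pzRingType) (A B : comPzAlgType k) (f : algHom A B) n
    (a : Vboxplus A) :
  cumulant B n (Vmap f a) = f (cumulant A n a).
Proof. exact: Rtransform_Vmap. Qed.

Section Comultiplication.
Variables (k : pzRingType) (A : comPzAlgType k).
Implicit Types (a : Vboxplus A) (u v : Vboxplus (Vboxplus A)).

Lemma cumulant2_inj u v :
  (forall m n, cumulant A n (cumulant (Vboxplus A) m u) =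
               cumulant A n (cumulant (Vboxplus A) m v)) -> u = v.
Proof. by move=> uv; do 2![apply: cumulant_inj => ?]; apply: uv. Qed.

(** The two layers of inverse R-transforms in [Delta] are undone by the two
    cumulants, outer layer first, which leaves only the shift [delta]. Counting
    indices from [0] turns the shift [m + n - 1] of the Hankel array into the
    monoid law [m + n], and this is what makes [Delta] coassociative. *)
Lemma cumulant_Delta a m n :
  cumulant A n (cumulant (Vboxplus A) m (Delta a)) = cumulant A (m + n) a.
Proof. by rewrite /= !RinvK. Qed.

Lemma Delta_zmod : zmod_morphism (@Delta A).
Proof.
move=> a b; apply: cumulant2_inj => m n; rewrite cumulant_Delta !rmorphB.
by congr (_ - _); apply/esym/cumulant_Delta.
Qed.

Lemma Delta_monoid : monoid_morphism (@Delta A).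
Proof.
split=> [|a b]; apply: cumulant2_inj => m n.
  by rewrite cumulant_Delta !rmorph1.
by rewrite cumulant_Delta !rmorphM; congr (_ * _); apply/esym/cumulant_Delta.
Qed.

Lemma Delta_scale (c : k) a : Delta (ascale c a) = ascale c (Delta a).
Proof.
by apply: cumulant2_inj => m n; rewrite !(algHom_scale, cumulant_Delta).
Qed.

Definition Delta_hom : algHom (Vboxplus A) (Vboxplus (Vboxplus A)) :=
  AlgHom Delta_zmod Delta_monoid Delta_scale.
End Comultiplication.

Section Comonad.
Variable k : pzRingType.
Implicit Types A B : comPzAlgType k.

Lemma Delta_natural A B (f : algHom A B) :
  algHom_comp (Delta_hom B) (Vmap f) =
  algHom_comp (Vmap (Vmap f)) (Delta_hom A).
Proof.
apply: algHom_eq => a; apply: cumulant2_inj => m n.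
by rewrite [LHS]cumulant_Delta !cumulant_Vmap cumulant_Delta.
Qed.

Lemma epsilon_natural A B (f : algHom A B) :
  algHom_comp (cumulant B 0) (Vmap f) = algHom_comp f (cumulant A 0).
Proof. by apply: algHom_eq => a; apply: cumulant_Vmap. Qed.

(** Both sides have iterated cumulants indexed by triples [(l, m, n)]: they are
    the cumulants of [a] at [(l + m) + n] and at [l + (m + n)]. *)
Lemma Delta_coassoc A :
  algHom_comp (Delta_hom (Vboxplus A)) (Delta_hom A) =
  algHom_comp (Vmap (Delta_hom A)) (Delta_hom A).
Proof.
apply: algHom_eq => a; apply: cumulant2_inj => l m; apply: cumulant_inj => n.
rewrite [in LHS]cumulant_Delta cumulant_Delta.
by rewrite cumulant_Vmap !cumulant_Delta addnA.
Qed.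

Lemma epsilon_Delta A :
  algHom_comp (cumulant (Vboxplus A) 0) (Delta_hom A) =
  algHom_id (Vboxplus A).
Proof.
by apply: algHom_eq => a; apply: cumulant_inj => n; rewrite cumulant_Delta.
Qed.

Lemma Vmap_epsilon_Delta A :
  algHom_comp (Vmap (cumulant A 0)) (Delta_hom A) = algHom_id (Vboxplus A).
Proof.
apply: algHom_eq => a; apply: cumulant_inj => n.
by rewrite cumulant_Vmap cumulant_Delta addn0.
Qed.

Definition Delta_nattrans :
    nattrans (Vboxplus_functor k)
      (functor_comp (Vboxplus_functor k) (Vboxplus_functor k)) :=
  @NatTrans (cAlg k) (cAlg k) (Vboxplus_functor k)
    (functor_comp (Vboxplus_functor k) (Vboxplus_functor k))
    (@Delta_hom k) Delta_natural.

Definition epsilon_nattrans :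
    nattrans (Vboxplus_functor k) (functor_id (cAlg k)) :=
  @NatTrans (cAlg k) (cAlg k) (Vboxplus_functor k) (functor_id (cAlg k))
    (fun A => cumulant A 0) epsilon_natural.

Definition Vboxplus_comonad : comonad (Vboxplus_functor k) :=
  @Comonad (cAlg k) (Vboxplus_functor k) Delta_nattrans epsilon_nattrans
    Delta_coassoc epsilon_Delta Vmap_epsilon_Delta.
End Comonad.

Theorem theorem3p16 (k : fieldType) (char0 : [pchar k]%R =i pred0) :
  exists D : comonad (Vboxplus_functor k),
    (forall (A : comPzAlgType k) (a : Vboxplus A),
       (comult D A : algHom (Vboxplus A) (Vboxplus (Vboxplus A))) a = Delta a) /\
    (forall (A : comPzAlgType k) (a : Vboxplus A),
       (counit D A : algHom (Vboxplus A) A) a = epsilon a).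
Proof. by exists (Vboxplus_comonad k). Qed.
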